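(* Let $\bar R>0$. The compress-forward (CF) lower bound $R_{\mathrm{sym},\diamond,\mathrm{CF}}(\bar R)$ for the anti-symmetric Gaussian primitive diamond channel (all quantities defined in the context, as functions of the power $P>0$) satisfies the following: (a) For all $P>0$, $R_{\mathrm{sym},\diamond,\mathrm{CF}}(\bar R)<R_{\mathrm{sym},\diamond,\mathrm{MQ\text{-}DF}}(\bar R)$. (b) $$R_{\mathrm{sym},\diamond,\mathrm{CF}}(\bar R)\ \begin{cases}<R_{\mathrm{sym},\diamond,\mathrm{MQ}}(\bar R)=\bar R,&P<1,\\ =R_{\mathrm{sym},\diamond,\mathrm{MQ}}(\bar R)=\bar R,&P=1,\\ >R_{\mathrm{sym},\diamond,\mathrm{MQ}}(\bar R)=\bar R,&P>1.\end{cases}$$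
   Context: All logarithms are base 2, $\psi(x)=\frac12\log(1+x)$, $\bar\gamma=1-\gamma$. The anti-symmetric Gaussian primitive diamond channel is the channel in which two relays observe $Y_1=X+Z$ and $Y_2=-X+Z$ with common noise $Z\sim\mathcal N(0,1)$, the input has power constraint $P$, and each relay has a noiseless link of capacity $\bar R$ to the receiver. The achievable rates are defined as follows. CF rate (Gaussian codebook and Gaussian quantization with equal quantization noise levels $N_1=N_2=N$): $$R_{\mathrm{sym},\diamond,\mathrm{CF}}(\bar R)=\max_{N>0}\min\left\{\tfrac12\log\left(1+\tfrac{2P}{N}\right),\ \bar R+\tfrac12\log\left(1+\tfrac{P-1}{N+2}\right),\ 2\bar R+\tfrac12\log\left(\tfrac{N}{N+2}\right)\right\}.$$ MQ rate: $R_{\mathrm{sym},\diamond,\mathrm{MQ}}(\bar R)=\bar R$ (the minimum of the two relay-link capacities). MQ-DF rate: $$R_{\mathrm{sym},\diamond,\mathrm{MQ\text{-}DF}}(\bar R)=\max_{\gamma\in[0,1],\,\rho\in[0,\bar R]}\min\left\{2\bar R-\rho,\ \bar R+\psi\!\left(\tfrac{\bar\gamma P}{\gamma P+1}\right),\ \psi(\gamma P)+\psi\!\left(\tfrac{\bar\gamma P}{\gamma P+1}\right)+\rho\right\}.$$ *)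

(* Defs.v *)
From HB Require Import structures.
From mathcomp Require Import all_boot all_order all_algebra.
From mathcomp Require Import ring lra.
From mathcomp Require Import all_classical all_reals all_analysis.

Set Implicit Arguments.
Unset Strict Implicit.
Unset Printing Implicit Defensive.

Import Order.TTheory GRing.Theory Num.Theory.
Import numFieldNormedType.Exports.
Local Open Scope classical_set_scope.
Local Open Scope ring_scope.

Section rates.
Context {R : realType}.
Implicit Types P Rbar N g rho : R.

(* [ln] vanishes on nonpositive reals; all arguments below are positive when
   [0 < P], [0 < N] and [0 <= g <= 1]. *)
Definition log2 (x : R) : R := ln x / ln 2.

Definition psi (x : R) : R := 2^-1 * log2 (1 + x).

Definition cf_objective P Rbar N : R :=
  Num.min (2^-1 * log2 (1 + 2 * P / N))
    (Num.min (Rbar + 2^-1 * log2 (1 + (P - 1) / (N + 2)))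
             (2 * Rbar + 2^-1 * log2 (N / (N + 2)))).

(* The maxima over [N], and over [(g, rho)] in [mqdf_rate], are written as
   suprema; [cf_rate_max] and [mqdf_rate_max] show that both are attained. *)
Definition cf_rate P Rbar : R :=
  sup [set cf_objective P Rbar N | N in [set N | 0 < N]].

(* Both relay links have capacity [Rbar]. *)
Definition mq_rate Rbar : R := Num.min Rbar Rbar.

Definition mqdf_objective P Rbar g rho : R :=
  Num.min (2 * Rbar - rho)
    (Num.min (Rbar + psi ((1 - g) * P / (g * P + 1)))
             (psi (g * P) + psi ((1 - g) * P / (g * P + 1)) + rho)).

Definition mqdf_rate P Rbar : R :=
  sup [set r | exists g rho, [/\ 0 <= g <= 1, 0 <= rho <= Rbar &
                                r = mqdf_objective P Rbar g rho]].

Let ln2_gt0 : 0 < ln (2 : R). Proof. by rewrite ln_gt0// ltr1n. Qed.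

Let sup_maximum (A : set R) x : A x -> ubound A x -> sup A = x.
Proof.
move=> Ax ubx; apply/eqP; rewrite eq_le ge_sup//=; last by exists x.
by apply: ub_le_sup => //; exists x.
Qed.

Let log2_le (x y : R) : 0 < x -> x <= y -> log2 x <= log2 y.
Proof.
move=> x0 xy; rewrite /log2 ler_pM2r ?invr_gt0// ler_ln ?posrE//.
exact: lt_le_trans xy.
Qed.

Let log2_lt (x y : R) : 0 < x -> x < y -> log2 x < log2 y.
Proof.
move=> x0 xy; rewrite /log2 ltr_pM2r ?invr_gt0// ltr_ln ?posrE//.
exact: lt_trans xy.
Qed.

Let log2_expR (x : R) : log2 (expR (x * ln 2)) = x.
Proof. by rewrite /log2 expRK mulfK// gt_eqF. Qed.

Let log2_cvg (f : R -> R) x : 0 < f x -> {for x, continuous f} ->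
  {for x, continuous (fun y => 2^-1 * log2 (f y))}.
Proof.
move=> fx cf; apply: cvgM; first exact: cvg_cst.
apply: cvgM; last exact: cvg_cst.
by apply: (@continuous_comp _ _ _ f (@ln R)) => //; exact: continuous_ln.
Qed.

Let cf_objective_continuous P Rbar N : 0 < P -> 0 < N ->
  {for N, continuous (cf_objective P Rbar)}.
Proof.
move=> P0 N0.
have N20 : 0 < N + 2 by lra.
have cN2 : (fun y : R => (y + 2)^-1) @ N --> (N + 2)^-1.
  by apply: cvgV; [rewrite gt_eqF | apply: cvgD; [exact: cvg_id|exact: cvg_cst]].
apply: continuous_min.
  apply: log2_cvg; first by rewrite addr_gt0// divr_gt0// mulr_gt0.
  apply: cvgD; first exact: cvg_cst.
  apply: cvgM; first exact: cvg_cst.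
  by apply: cvgV; [rewrite gt_eqF|exact: cvg_id].
apply: continuous_min.
  apply: cvgD; first exact: cvg_cst.
  apply: (@log2_cvg (fun y => 1 + (P - 1) / (y + 2))).
    suff -> : 1 + (P - 1) / (N + 2) = (N + 1 + P) / (N + 2).
      by rewrite divr_gt0//; lra.
    by field; rewrite gt_eqF.
  apply: cvgD; first exact: cvg_cst.
  by apply: cvgM; first exact: cvg_cst.
apply: cvgD; first exact: cvg_cst.
apply: (@log2_cvg (fun y => y / (y + 2))); first by rewrite divr_gt0.
by apply: cvgM => //; exact: cvg_id.
Qed.

Lemma cf_rate_max P Rbar : 0 < P -> 0 < Rbar ->
  exists2 N, 0 < N & cf_rate P Rbar = cf_objective P Rbar N /\
    forall N', 0 < N' -> cf_objective P Rbar N' <= cf_objective P Rbar N.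
Proof.
move=> P0 R0.
suff [N N0 maxN] : exists2 N, 0 < N &
    forall N', 0 < N' -> cf_objective P Rbar N' <= cf_objective P Rbar N.
  exists N => //; split=> //; apply: sup_maximum; first by exists N.
  by move=> _ [N' N'0 <-]; exact: maxN.
pose d := expR (- (2 * Rbar) * ln 2).
have d0 : 0 < d by exact: expR_gt0.
have d1 : d < 1 by rewrite -expR0 ltr_expR mulNr oppr_lt0 !mulr_gt0.
have d'0 : 0 < 1 - d by lra.
pose N0 := 2 / (1 - d).
have N00 : 0 < N0 by rewrite divr_gt0.
have dN0 : d < N0 / (N0 + 2).
  rewrite ltr_pdivlMr ?addr_gt0//.
  rewrite -(ltr_pM2r d'0).
  have N0d : N0 * (1 - d) = 2 by rewrite /N0 divfK// gt_eqF.
  rewrite N0d -mulrA mulrDl N0d; have : 0 < (1 - d) ^+ 2 by rewrite exprn_gt0.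
  by nra.
pose m := cf_objective P Rbar N0.
have m0 : 0 < m.
  rewrite /m /cf_objective !lt_min; apply/and3P; split.
  - rewrite mulr_gt0// divr_gt0// ln_gt0// ltrDl divr_gt0// mulr_gt0//.
  - have : - (2 * Rbar) < log2 (1 + (P - 1) / (N0 + 2)).
      rewrite -(log2_expR (- (2 * Rbar))); apply: log2_lt => //.
      apply: (lt_trans dN0).
      suff -> : 1 + (P - 1) / (N0 + 2) = (N0 + 1 + P) / (N0 + 2).
        by rewrite ltr_pM2r ?invr_gt0 ?addr_gt0//; lra.
      by field; rewrite gt_eqF// addr_gt0.
    by lra.
  - have : - (2 * Rbar) < log2 (N0 / (N0 + 2)).
      by rewrite -(log2_expR (- (2 * Rbar))); exact: log2_lt.
    by lra.
pose a := expR (- (4 * Rbar) * ln 2) * 2.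
have a0 : 0 < a by rewrite mulr_gt0// expR_gt0.
have small N : 0 < N -> N <= a -> cf_objective P Rbar N <= 0.
  move=> N_0 Na; rewrite /cf_objective !ge_min; apply/orP; right; apply/orP; right.
  have : log2 (N / (N + 2)) <= - (4 * Rbar).
    rewrite -(log2_expR (- (4 * Rbar))); apply: log2_le.
      by rewrite divr_gt0// addr_gt0.
    rewrite ler_pdivrMr ?addr_gt0//; apply: (le_trans Na).
    by rewrite /a ler_pM2l ?expR_gt0//; lra.
  by lra.
pose b := Num.max N0 (P / (m * ln 2)).
have large N : b <= N -> cf_objective P Rbar N <= m.
  rewrite ge_max => /andP[N0N PN]; rewrite /cf_objective ge_min; apply/orP; left.
  have N_0 : 0 < N by exact: lt_le_trans N0N.
  move: PN; rewrite ler_pdivrMr ?mulr_gt0// => PN.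
  have : ln (1 + 2 * P / N) <= 2 * P / N.
    by apply: le_ln1Dx; rewrite (lt_trans (_ : -1 < 0)) ?divr_gt0 ?mulr_gt0//; lra.
  have : 2 * P / N <= 2 * (m * ln 2).
    by rewrite ler_pdivrMr//; lra.
  move=> h1 /le_trans /(_ h1) h2.
  by rewrite /log2 mulrA ler_pdivrMr//; lra.
have aN0 : a <= N0.
  rewrite leNgt; apply/negP => /ltW /(small _ N00).
  by rewrite leNgt; apply/negP; rewrite negbK.
have N0b : N0 <= b by rewrite le_max lexx.
have cf : {within `[a, b], continuous (cf_objective P Rbar)}.
  apply: continuous_in_subspaceT => x; rewrite inE/= in_itv/= => /andP[ax _].
  by apply: cf_objective_continuous => //; exact: lt_le_trans ax.
have [c] := EVT_max (le_trans aN0 N0b) cf.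
rewrite in_itv/= => /andP[ac cb] maxc.
have mc : m <= cf_objective P Rbar c by apply: maxc; rewrite in_itv/= aN0.
exists c; first exact: lt_le_trans ac.
move=> N N_0; have [Na|aN] := leP N a.
  exact: le_trans (small _ N_0 Na) (le_trans (ltW m0) mc).
have [Nb|bN] := leP N b; first by apply: maxc; rewrite in_itv/= (ltW aN).
exact: le_trans (large _ (ltW bN)) mc.
Qed.

Lemma mqdf_rate_max P Rbar : 0 < P -> 0 < Rbar ->
  exists g rho, [/\ 0 <= g <= 1, 0 <= rho <= Rbar,
    mqdf_rate P Rbar = mqdf_objective P Rbar g rho &
    forall g' rho', 0 <= g' <= 1 -> 0 <= rho' <= Rbar ->
      mqdf_objective P Rbar g' rho' <= mqdf_objective P Rbar g rho].
Proof.
move=> P0 R0.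
suff [g [rho [hg hrho hmax]]] : exists g rho,
    [/\ 0 <= g <= 1, 0 <= rho <= Rbar &
    forall g' rho', 0 <= g' <= 1 -> 0 <= rho' <= Rbar ->
      mqdf_objective P Rbar g' rho' <= mqdf_objective P Rbar g rho].
  exists g, rho; split=> //; apply: sup_maximum; first by exists g, rho.
  by move=> _ [g' [rho' [hg' hrho' ->]]]; exact: hmax.
have cf : {within `[0, Rbar], continuous (mqdf_objective P Rbar 0)}.
  apply: continuous_subspaceT => x.
  suff : {for x, continuous (mqdf_objective P Rbar 0)} by [].
  apply: continuous_min.
    by apply: cvgB; [exact: cvg_cst|exact: cvg_id].
  apply: continuous_min; first exact: cvg_cst.
  by apply: cvgD; [exact: cvg_cst|exact: cvg_id].
have [c] := EVT_max (ltW R0) cf; rewrite in_itv/= => hc maxc.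
exists 0, c; split=> // [|g rho /andP[g0 g1] hrho]; first by rewrite lexx ler01.
apply: le_trans (maxc rho _); last by rewrite in_itv.
have gP : 0 <= g * P by rewrite mulr_ge0// ltW.
have gP1 : 0 < g * P + 1 by lra.
have e : 1 + (1 - g) * P / (g * P + 1) = (1 + P) / (1 + g * P).
  by rewrite [1 + g * P]addrC; field; rewrite gt_eqF.
have psiP : psi (g * P) + psi ((1 - g) * P / (g * P + 1)) = psi P.
  rewrite /psi e -mulrDr /log2 -mulrDl ln_div ?posrE; [|lra|lra].
  by rewrite addrC subrK.
have psi0 : psi (0 : R) = 0 by rewrite /psi /log2 addr0 ln1 mul0r mulr0.
have psig : 0 <= psi (g * P).
  by rewrite /psi mulr_ge0// divr_ge0// ln_ge0//; lra.
rewrite /mqdf_objective psiP subr0 !mul0r add0r mul1r divr1 psi0 add0r.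
rewrite !le_min !ge_min !lexx /= ?orbT /= andbT.
by apply/orP; right; apply/orP; left; rewrite lerD2l -psiP lerDr.
Qed.

End rates.

(* Main.v *)
Require Import Defs.
From mathcomp Require Import all_boot all_order all_algebra.
From mathcomp Require Import ring lra.
From mathcomp Require Import all_classical all_reals all_analysis.
Import Order.TTheory GRing.Theory Num.Theory.
Local Open Scope ring_scope.

(** For (a), at every noise level [N] the first and third terms of the CF
  objective average to [Rbar + log2 ((N + 2P) / (N + 2)) / 4], which is less
  than [Rbar + psi P / 2]; moreover the third term is less than [2 * Rbar].
  Taking [g = 0] and balancing the first and third terms over [rho], MQ-DF
  achieves [min (Rbar + psi P / 2) (2 * Rbar)].

  For (b), the second term of the CF objective compares with [Rbar] as [P] does
  with [1]; writing [s = 2 ^ (2 * Rbar)], the other two terms are both at least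
  [Rbar] exactly when [2 <= N * (s - 1) <= 2 * P]. *)

Lemma ln2_gt0 (R : realType) : 0 < ln (2 : R).
Proof. by rewrite ln_gt0// ltr1n. Qed.

Lemma ltr_log2 (R : realType) (x y : R) : 0 < x -> x < y -> log2 x < log2 y.
Proof.
move=> x0 xy; rewrite /log2 ltr_pM2r ?invr_gt0 ?ln2_gt0// ltr_ln ?posrE//.
exact: lt_trans xy.
Qed.

Lemma log2_1 (R : realType) : log2 (1 : R) = 0.
Proof. by rewrite /log2 ln1 mul0r. Qed.

Lemma log2M (R : realType) (x y : R) :
  0 < x -> 0 < y -> log2 (x * y) = log2 x + log2 y.
Proof. by move=> x0 y0; rewrite /log2 lnM ?posrE// mulrDl. Qed.

Lemma log2V (R : realType) (x : R) : 0 < x -> log2 x^-1 = - log2 x.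
Proof. by move=> x0; rewrite /log2 lnV ?posrE// mulNr. Qed.

(** The witness is 2 ^ r, written with [expR]. It turns bounds on logarithms into rational
    inequalities in [s]. *)
Lemma exists_log2 (R : realType) (r : R) :
  0 < r -> exists2 s : R, 1 < s & log2 s = r.
Proof.
move=> r0; exists (expR (r * ln 2)).
  by rewrite expR_gt1 mulr_gt0 ?ln2_gt0.
by rewrite /log2 expRK mulfK// gt_eqF ?ln2_gt0.
Qed.

Lemma cf_rate_ge (R : realType) (P Rbar N : R) :
  0 < P -> 0 < Rbar -> 0 < N -> cf_objective P Rbar N <= cf_rate P Rbar.
Proof.
by move=> P0 R0 N0; have [N' _ [-> maxN']] := cf_rate_max P0 R0; exact: maxN'.
Qed.

Lemma mqdf_objective0 (R : realType) (P Rbar rho : R) :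
  mqdf_objective P Rbar 0 rho =
    Num.min (2 * Rbar - rho) (Num.min (Rbar + psi P) (psi P + rho)).
Proof.
have psi0 : psi (0 : R) = 0 by rewrite /psi addr0 log2_1 mulr0.
by rewrite /mqdf_objective (subr0 1) !mul0r add0r mul1r divr1 psi0 add0r.
Qed.

Lemma mqdf_rate_ge (R : realType) (P Rbar : R) : 0 < P -> 0 < Rbar ->
  Num.min (Rbar + psi P / 2) (2 * Rbar) <= mqdf_rate P Rbar.
Proof.
move=> P0 R0; have [g [rho [_ _ -> maxgr]]] := mqdf_rate_max P0 R0.
have p0 : 0 < psi P.
  by rewrite /psi mulr_gt0// -(log2_1 R) ltr_log2// ltrDl.
have h01 : 0 <= (0 : R) <= 1 by rewrite lexx ler01.
(* The balancing value [Rbar - psi P / 2] is an admissible [rho] only while it is nonnegative.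
   Otherwise [rho = 0] already leaves [2 * Rbar] as the smallest term. *)
have [h|h] := leP (psi P) (2 * Rbar).
- have hrho : 0 <= Rbar - psi P / 2 <= Rbar by apply/andP; split; lra.
  apply: le_trans (maxgr _ _ h01 hrho).
  by rewrite mqdf_objective0 ge_min; apply/orP; left; rewrite !le_min; apply/and3P; split; lra.
- have hrho : 0 <= (0 : R) <= Rbar by rewrite lexx ltW.
  apply: le_trans (maxgr _ _ h01 hrho).
  by rewrite mqdf_objective0 ge_min; apply/orP; right; rewrite !le_min; apply/and3P; split; lra.
Qed.

Lemma cf_objective_lt (R : realType) (P Rbar N : R) : 0 < P -> 0 < N ->
  cf_objective P Rbar N < Num.min (Rbar + psi P / 2) (2 * Rbar).
Proof.
move=> P0 N0; have N2 : 0 < N + 2 by lra.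
have q0 : 0 < N / (N + 2) by rewrite divr_gt0.
have a0 : 0 < 1 + 2 * P / N by rewrite addr_gt0// divr_gt0// mulr_gt0.
have avg : log2 (1 + 2 * P / N) + log2 (N / (N + 2)) < log2 (1 + P).
  rewrite -log2M//; apply: ltr_log2; first exact: mulr_gt0.
  have -> : (1 + 2 * P / N) * (N / (N + 2)) = (N + 2 * P) / (N + 2).
    by field; rewrite !gt_eqF.
  (* After cross-multiplication the gap is [N * P + 2]. *)
  by rewrite ltr_pdivrMr//; nra.
have q1 : log2 (N / (N + 2)) < 0.
  by rewrite -(log2_1 R) ltr_log2// ltr_pdivrMr//; lra.
rewrite /cf_objective /psi lt_min !gt_min; apply/andP; split; last first.
  by apply/orP; right; apply/orP; right; lra.
(* If the first term reaches the bound, [avg] forces the third one below it. *)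
have [//|h] := ltP (2^-1 * log2 (1 + 2 * P / N)) (Rbar + 2^-1 * log2 (1 + P) / 2).
by apply/orP; right; lra.
Qed.

(** For [0 < P] the quotient is visibly positive, even when [P < 1], and comparing it with 1 amounts
    to comparing [P] with 1. *)
Lemma cf_second_argE (R : realType) (P N : R) :
  0 < N -> 1 + (P - 1) / (N + 2) = (N + 1 + P) / (N + 2).
Proof. by move=> N0; field; rewrite gt_eqF//; lra. Qed.

Lemma cf_rate_lt (R : realType) (P Rbar : R) :
  0 < P -> 0 < Rbar -> P < 1 -> cf_rate P Rbar < Rbar.
Proof.
move=> P0 R0 P1; have [N N0 [-> _]] := cf_rate_max P0 R0.
rewrite /cf_objective !gt_min; apply/orP; right; apply/orP; left.
suff : log2 (1 + (P - 1) / (N + 2)) < 0 by lra.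
rewrite -(log2_1 R) cf_second_argE//; apply: ltr_log2.
  by rewrite divr_gt0//; lra.
by rewrite ltr_pdivrMr//; lra.
Qed.

Lemma cf_rate1 (R : realType) (Rbar : R) : 0 < Rbar -> cf_rate 1 Rbar = Rbar.
Proof.
move=> R0; apply/eqP; rewrite eq_le; apply/andP; split.
  have [N N0 [-> _]] := cf_rate_max ltr01 R0.
  by rewrite /cf_objective !ge_min subrr mul0r addr0 log2_1 mulr0 addr0 lexx orbT.
have [s s1 sE] := @exists_log2 R (2 * Rbar) ltac:(lra).
have s0 : 0 < s - 1 by lra.
(* At [P = 1] the range [2 <= N * (s - 1) <= 2 * P] shrinks to this single noise level, where all
   three terms equal [Rbar]. *)
have N0 : 0 < 2 / (s - 1) by rewrite divr_gt0.
apply: le_trans (cf_rate_ge _ _ _ _ ltr01 R0 N0).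
rewrite /cf_objective subrr mul0r addr0 log2_1 mulr0 addr0.
have -> : 1 + 2 * 1 / (2 / (s - 1)) = s by field; rewrite gt_eqF.
have -> : 2 / (s - 1) / (2 / (s - 1) + 2) = s^-1.
  by field; rewrite !gt_eqF//; lra.
rewrite log2V ?sE; last by lra.
by rewrite !le_min; apply/and3P; split; lra.
Qed.

Lemma cf_rate_gt (R : realType) (P Rbar : R) :
  0 < Rbar -> 1 < P -> Rbar < cf_rate P Rbar.
Proof.
move=> R0 P1; have P0 : 0 < P by lra.
have [s s1 sE] := @exists_log2 R (2 * Rbar) ltac:(lra).
have s0 : 0 < s - 1 by lra.
(* The midpoint of the range for [N * (s - 1)], now of positive length, makes the first and third
   terms strictly exceed [Rbar]. *)
pose N := (1 + P) / (s - 1).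
have N0 : 0 < N by rewrite divr_gt0//; lra.
have NE : N * (s - 1) = 1 + P by rewrite /N divfK// gt_eqF.
apply: lt_le_trans (cf_rate_ge _ _ _ _ P0 R0 N0).
have h1 : 2 * Rbar < log2 (1 + 2 * P / N).
  rewrite -sE ltr_log2//; first lra.
  by rewrite -ltrBlDl ltr_pdivlMr//; lra.
have h2 : 0 < log2 (1 + (P - 1) / (N + 2)).
  by rewrite -(log2_1 R) ltr_log2// ltrDl divr_gt0//; lra.
have h3 : - (2 * Rbar) < log2 (N / (N + 2)).
  rewrite -sE -log2V; last by lra.
  apply: ltr_log2; first by rewrite invr_gt0; lra.
  rewrite ltr_pdivlMr; last by lra.
  by rewrite mulrC ltr_pdivrMr//; lra.
by rewrite /cf_objective !lt_min; apply/and3P; split; lra.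
Qed.

Theorem proposition5 (R : realType) (Rbar : R) (Rbar_gt0 : 0 < Rbar) :
  (forall P : R, 0 < P -> cf_rate P Rbar < mqdf_rate P Rbar) /\
  (forall P : R, 0 < P ->
    [/\ mq_rate Rbar = Rbar,
        P < 1 -> cf_rate P Rbar < mq_rate Rbar,
        P = 1 -> cf_rate P Rbar = mq_rate Rbar
      & 1 < P -> mq_rate Rbar < cf_rate P Rbar]).
Proof.
split=> P P0; last first.
  rewrite /mq_rate minxx; split=> // [|->|]; first exact: cf_rate_lt.
    exact: cf_rate1.
  exact: cf_rate_gt.
apply: lt_le_trans (mqdf_rate_ge _ _ _ P0 Rbar_gt0).
(* Since the CF maximum is attained, the strict bound at each [N] stays strict for the rate. *)
have [N N0 [-> _]] := cf_rate_max P0 Rbar_gt0.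
exact: cf_objective_lt.
Qed.
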